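(* Let $M$, $n=\dim M\geq4$, be a Chen ideal submanifold of codimension $m$, $m\geq1$, isometrically immersed in a Euclidean space $\mathbb E^{n+m}$. Then on ${\mathcal U}_C\subset M$ $$C\cdot R+R\cdot C=Q(S,C)+(L+L_C)\,Q(g,C)-\frac1{(n-2)^2}\,Q\Big(g,\frac{n-2}2\,S\wedge S-\kappa\,g\wedge S+g\wedge S^2\Big),$$ where $L$ and $L_C$ are the functions on ${\mathcal U}_C$ for which $R\cdot R-Q(S,R)=L\,Q(g,C)$ and $C\cdot C=L_C\,Q(g,C)$.
   Context: All manifolds are connected, paracompact and of class $C^\infty$. A submanifold $M^n$ of $\mathbb E^{n+m}$ with induced metric $g$ is a Chen ideal submanifold if at every point it realizes equality in Chen's inequality $\tau-\inf K\le\frac{n^2(n-2)}{2(n-1)}|\vec H|^2$, where $\tau=\frac{\kappa}{2}=\sum_{i<j}K(e_i\wedge e_j)$ for an orthonormal frame, $\inf K$ is the infimum of the sectional curvatures at the point, and $\vec H=\frac1n\mathrm{tr}\,h$ is the mean curvature vector ($h$ the second fundamental form). It is known that on ${\mathcal U}_C$ of a Chen ideal submanifold the conditions $R\cdot R-Q(S,R)=L\,Q(g,C)$ and $C\cdot C=L_C\,Q(g,C)$ hold for some functions $L$, $L_C$. For a semi-Riemannian manifold $(M,g)$, $n=\dim M$, with Levi-Civita connection $\nabla$: ${\mathcal R}(X,Y)Z=\nabla_X\nabla_YZ-\nabla_Y\nabla_XZ-\nabla_{[X,Y]}Z$, $R(X_1,X_2,X_3,X_4)=g({\mathcal R}(X_1,X_2)X_3,X_4)$,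 $S(X,Y)=\mathrm{tr}\{Z\mapsto{\mathcal R}(Z,X)Y\}$, $g({\mathcal S}X,Y)=S(X,Y)$, $S^2(X,Y)=S({\mathcal S}X,Y)$, $\kappa=\mathrm{tr}\,{\mathcal S}$. For symmetric $(0,2)$-tensors $E,F$: $(E\wedge F)(X_1,X_2,X_3,X_4)=E(X_1,X_4)F(X_2,X_3)+E(X_2,X_3)F(X_1,X_4)-E(X_1,X_3)F(X_2,X_4)-E(X_2,X_4)F(X_1,X_3)$; $G=\frac12g\wedge g$; $C=R-\frac1{n-2}g\wedge S+\frac\kappa{(n-2)(n-1)}G$ is the Weyl tensor; ${\mathcal U}_C$ is the set of points where $C\ne0$. For $B\in\{R,C\}$ define ${\mathcal B}$ by $g({\mathcal B}(X_1,X_2)X_3,X_4)=B(X_1,X_2,X_3,X_4)$; for a $(0,k)$-tensor $T$, $(B\cdot T)(X_1,\dots,X_k,X,Y)=-\sum_iT(X_1,\dots,{\mathcal B}(X,Y)X_i,\dots,X_k)$. For a symmetric $(0,2)$-tensor $A$, $(X\wedge_AY)Z=A(Y,Z)X-A(X,Z)Y$ and $Q(A,T)(X_1,\dots,X_k,X,Y)=-\sum_iT(X_1,\dots,(X\wedge_AY)X_i,\dots,X_k)$. *)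

(* Defs.v *)
From HB Require Import structures.
From mathcomp Require Import all_boot all_order all_algebra.
From mathcomp Require Import boolp classical_sets functions cardinality.
From mathcomp Require Import reals topology normedtype derive.

Set Implicit Arguments.
Unset Strict Implicit.
Unset Printing Implicit Defensive.
Import Order.TTheory GRing.Theory Num.Theory numFieldNormedType.Exports.
Local Open Scope classical_set_scope.
Local Open Scope ring_scope.

Section SmoothManifolds.
Context {R : realType}.

Fixpoint class_C (k : nat) (n N : nat) (A : set 'rV[R]_n)
    (f : 'rV[R]_n -> 'rV[R]_N) : Prop :=
  match k with
  | 0%N => {in A, continuous f}
  | k'.+1 => (forall x, A x -> differentiable f x) /\
             (forall v, class_C k' A (fun x => 'D_v f x))
  end.

(* Only used for open [A]. *)
Definition smooth_on (n N : nat) (A : set 'rV[R]_n)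
    (f : 'rV[R]_n -> 'rV[R]_N) : Prop :=
  forall k, class_C k A f.

Definition locally_finite (M : topologicalType) (U : set (set M)) : Prop :=
  forall p : M, exists2 W, nbhs p W &
    finite_set [set V | U V /\ V `&` W !=set0].

Definition paracompact (M : topologicalType) : Prop :=
  forall U : set (set M),
    (forall V, U V -> open V) -> (forall p, exists2 V, U V & V p) ->
    exists U' : set (set M),
      [/\ forall V, U' V -> open V,
          forall p, exists2 V, U' V & V p,
          forall V, U' V -> exists2 W, U W & V `<=` W
        & locally_finite U'].

(* The two maps are total; they are meaningful on [dom] and on its image only. *)
Record chart (M : topologicalType) (n : nat) := Chart {
  dom : set M;
  to_coord :> M -> 'rV[R]_n;
  of_coord : 'rV[R]_n -> M }.

Definition codom_chart (M : topologicalType) n (c : chart M n)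
  : set 'rV[R]_n := c @` dom c.

Definition is_chart (M : topologicalType) n (c : chart M n) : Prop :=
  [/\ open (dom c), open (codom_chart c),
      {in dom c, cancel c (of_coord c)},
      {in dom c, continuous c}
    & {in codom_chart c, continuous (of_coord c)}].

Definition smooth_manifold (M : topologicalType) n (A : set (chart M n))
  : Prop :=
  [/\ hausdorff_space M, connected [set: M], paracompact M &
   [/\ forall c, A c -> is_chart c,
       forall p, exists2 c, A c & dom c p
     & forall c c', A c -> A c' ->
         smooth_on (c @` (dom c `&` dom c')) (c' \o of_coord c)]].

Definition immersion (M : topologicalType) n N (A : set (chart M n))
    (f : M -> 'rV[R]_N) : Prop :=
  forall c, A c ->
    smooth_on (codom_chart c) (f \o of_coord c) /\
    forall x, codom_chart c x -> row_free ('J (f \o of_coord c) x).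

End SmoothManifolds.
Arguments chart : clear implicits.

(* Tensor algebra on one tangent space, identified with R^n by a chart. The   *)
(* scalar product [g] need not be the standard one of R^n.                    *)
Section TensorAlgebra.
Context {R : realType} {n : nat}.
Local Notation V := 'rV[R]_n.
Local Notation tensor2 := (V -> V -> R^o).
Local Notation tensor4 := (V -> V -> V -> V -> R^o).
Local Notation tensor6 := (V -> V -> V -> V -> V -> V -> R^o).
Local Notation e_ i := (delta_mx (0 : 'I_1) i : V).
Implicit Types (g E F S : tensor2) (B T : tensor4).

Definition gram g : 'M[R]_n := \matrix_(i, j) g (e_ i) (e_ j).

(* The vector [a] with [g a w = alpha w] for all [w]. *)
Definition sharp g (alpha : V -> R) : V :=
  (\row_k alpha (e_ k)) *m invmx (gram g).

Definition trace_op (f : V -> V) : R := \tr (lin1_mx f).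

Definition trace_form (N : nat) g (h : V -> V -> 'rV[R]_N) : 'rV[R]_N :=
  \sum_i \sum_j invmx (gram g) i j *: h (e_ i) (e_ j).

Definition kulkarni_nomizu E F : tensor4 := fun X1 X2 X3 X4 =>
  E X1 X4 * F X2 X3 + E X2 X3 * F X1 X4
  - E X1 X3 * F X2 X4 - E X2 X4 * F X1 X3.

Definition tensorG g : tensor4 := 2^-1 *: kulkarni_nomizu g g.

Definition oper2 g S : V -> V := fun X => sharp g (S X).

Definition square2 g S : tensor2 := fun X Y => S (oper2 g S X) Y.

Definition oper4 g B : V -> V -> V -> V := fun X1 X2 X3 => sharp g (B X1 X2 X3).

(* [act4 D T X1 X2 X3 X4 X Y] is the common pattern of [B . T] and [Q(A, T)]: *)
(* minus the sum of [T] with [X_i] replaced by [D X Y X_i].                   *)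
Definition act4 (D : V -> V -> V -> V) T : tensor6 := fun X1 X2 X3 X4 X Y =>
  - (T (D X Y X1) X2 X3 X4 + T X1 (D X Y X2) X3 X4
     + T X1 X2 (D X Y X3) X4 + T X1 X2 X3 (D X Y X4)).

Definition dot4 g B T : tensor6 := act4 (oper4 g B) T.

Definition wedge_op E : V -> V -> V -> V := fun X Y Z => E Y Z *: X - E X Z *: Y.

Definition tachibana E T : tensor6 := act4 (wedge_op E) T.

End TensorAlgebra.

(* Riemannian geometry of a metric [g] given on an open subset of R^n. *)
Section Riemannian.
Context {R : realType} {n : nat}.
Local Notation V := 'rV[R]_n.
Local Notation tensor2 := (V -> V -> R^o).
Local Notation tensor4 := (V -> V -> V -> V -> R^o).
Variable g : V -> tensor2.

(* Koszul formula for vector fields with constant components. *)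
Definition christoffel (x u v : V) : V :=
  sharp (g x) (fun w => 2^-1 * ('D_u (fun y => g y v w) x
    + 'D_v (fun y => g y u w) x - 'D_w (fun y => g y u v) x)).

Definition nabla (X Y : V -> V) : V -> V :=
  fun x => 'D_(X x) Y x + christoffel x (X x) (Y x).

Definition lie_bracket (X Y : V -> V) : V -> V :=
  fun x => 'D_(X x) Y x - 'D_(Y x) X x.

Definition curv_field (X Y Z : V -> V) : V -> V := fun x =>
  nabla X (nabla Y Z) x - nabla Y (nabla X Z) x - nabla (lie_bracket X Y) Z x.

(* By tensoriality, tangent vectors may be extended by constant components. *)
Definition curv_op (x u v w : V) : V :=
  curv_field (fun=> u) (fun=> v) (fun=> w) x.

Definition riemann (x : V) : tensor4 :=
  fun X1 X2 X3 X4 => g x (curv_op x X1 X2 X3) X4.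

Definition ricci (x : V) : tensor2 :=
  fun X Y => trace_op (fun Z => curv_op x Z X Y).

Definition scalar_curv (x : V) : R := trace_op (oper2 (g x) (ricci x)).

Definition weyl (x : V) : tensor4 :=
  riemann x - (n%:R - 2)^-1 *: kulkarni_nomizu (g x) (ricci x)
  + (scalar_curv x / ((n%:R - 2) * (n%:R - 1))) *: tensorG (g x).

Definition sectional (x u v : V) : R :=
  riemann x u v v u / (g x u u * g x v v - g x u v ^+ 2).

Definition inf_sectional (x : V) : R :=
  inf [set k | exists u v : V, row_free (col_mx u v) /\ k = sectional x u v].

End Riemannian.

Section Immersions.
Context {R : realType} {n N : nat}.
Local Notation V := 'rV[R]_n.
Local Notation E := 'rV[R]_N.

(* The norm that the library puts on row vectors is the sup norm. *)
Definition edot (a b : E) : R := \sum_k a 0 k * b 0 k.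

Definition induced_metric (F : V -> E) : V -> V -> V -> R^o :=
  fun x u v => edot ('D_u F x) ('D_v F x).

(* Gauss formula. *)
Definition second_form (F : V -> E) (x u v : V) : E :=
  'D_u (fun y => 'D_v F y) x
  - 'D_(nabla (induced_metric F) (fun=> u) (fun=> v) x) F x.

Definition mean_curv (F : V -> E) (x : V) : E :=
  n%:R^-1 *: trace_form (induced_metric F x) (second_form F x).

Definition chen_equality (F : V -> E) (x : V) : Prop :=
  let g := induced_metric F in
  scalar_curv g x / 2 - inf_sectional g x =
  n%:R ^+ 2 * (n%:R - 2) / (2 * (n%:R - 1))
  * edot (mean_curv F x) (mean_curv F x).

Context {M : topologicalType}.

Definition metric_in (f : M -> E) (c : chart R M n) : V -> V -> V -> R^o :=
  induced_metric (f \o of_coord c).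

Definition chen_ideal (A : set (chart R M n)) (f : M -> E) : Prop :=
  forall c p, A c -> dom c p -> chen_equality (f \o of_coord c) (c p).

(* Being nonzero does not depend on the chart. *)
Definition weyl_locus (A : set (chart R M n)) (f : M -> E) : set M :=
  [set p | exists c, [/\ A c, dom c p & weyl (metric_in f c) (c p) <> 0]].

End Immersions.

(* Main.v *)
(* Put A = R - C = (g /\ S)/(n-2) - kappa G/((n-2)(n-1)). By bilinearity of the
   dot action,
     C.R + R.C = R.R + C.C - A.A = Q(S,R) + (L + L_C) Q(g,C) - A.A,
   so it remains to evaluate Q(S,A) - A.A. This follows from
     Q(S,G) = - Q(g, g /\ S),  Q(S, g /\ S) = - Q(g, S /\ S)/2,
     (g /\ S).(g /\ S) = Q(g, g /\ S^2),  (g /\ S).G = 0,  G.T = Q(g,T),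
   which hold for every symmetric S. Geometry enters only through the
   multilinearity of R and the symmetry of S; both are read off the Gauss
   equation R(u,v,w,z) = <h(v,w), h(u,z)> - <h(u,w), h(v,z)> for the induced
   metric, whose derivation needs Schwarz' theorem on mixed derivatives. *)

Require Import Defs.
From mathcomp Require Import all_boot all_order all_algebra.
From mathcomp Require Import ring lra.
From mathcomp Require Import boolp classical_sets functions.
From mathcomp Require Import reals topology normedtype derive landau.
Import Order.TTheory GRing.Theory Num.Theory numFieldNormedType.Exports.
Local Open Scope classical_set_scope.
Local Open Scope ring_scope.

Set Implicit Arguments.
Unset Strict Implicit.
Unset Printing Implicit Defensive.

Ltac tensor6_ext X1 X2 X3 X4 X Y :=
  apply/funext => X1; apply/funext => X2; apply/funext => X3;
  apply/funext => X4; apply/funext => X; apply/funext => Y.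

(** Tensors take values in [R^o]; the scaling has to become a product before [field] can treat
    it. *)
Lemma scaleRoE (R : realType) (a : R) (b : R^o) : a *: b = a * b.
Proof. by []. Qed.

(** * Algebraic curvature identities *)

Section CurvatureAlgebra.
Context {R : realType} {n : nat}.
Local Notation V := 'rV[R]_n.
Local Notation tensor2 := (V -> V -> R^o).
Local Notation tensor4 := (V -> V -> V -> V -> R^o).
Local Notation e_ i := (delta_mx (0 : 'I_1) i : V).

(** * Linear forms and symmetric bilinear forms in coordinates *)

Section LinearForm.
Variable al : V -> R.
Hypothesis al_lin : forall a u v, al (a *: u + v) = a * al u + al v.

Lemma linear_form0 : al 0 = 0.
Proof.
apply: (@addrI R (al 0)); have := al_lin 1 0 0.
by rewrite scale1r mul1r !addr0.
Qed.

Lemma linear_form_lincomb c d u v : al (c *: u + d *: v) = c * al u + d * al v.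
Proof.
rewrite al_lin; congr (_ + _).
by have := al_lin d v 0; rewrite linear_form0 !addr0.
Qed.

Lemma linear_form_row u : al u = \sum_k u 0 k * al (e_ k).
Proof.
rewrite {1}(row_sum_delta u) (big_morph al (op1 := +%R) (id1 := 0)) => [|v w|].
- apply: eq_bigr => k _.
  by have := al_lin (u 0 k) (e_ k) 0; rewrite linear_form0 !addr0.
- by have := al_lin 1 v w; rewrite scale1r mul1r.
- exact: linear_form0.
Qed.

End LinearForm.

Definition symmetric_bilinear (E : tensor2) : Prop :=
  (forall a u v w, E (a *: u + v) w = a * E u w + E v w) /\
  (forall u v, E u v = E v u).

Section SymmetricBilinear.
Variable E : tensor2.
Hypothesis E_sb : symmetric_bilinear E.

Let ELC := E_sb.2.

Lemma sbDl u v w : E (u + v) w = E u w + E v w.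
Proof. by have := E_sb.1 1 u v w; rewrite scale1r mul1r. Qed.

Lemma sb0l w : E 0 w = 0.
Proof. by apply: (@addrI R (E 0 w)); rewrite -sbDl !addr0. Qed.

Lemma sbZl a u w : E (a *: u) w = a * E u w.
Proof. by have := E_sb.1 a u 0 w; rewrite addr0 sb0l addr0. Qed.

Lemma sbNl u w : E (- u) w = - E u w.
Proof. by rewrite -scaleN1r sbZl mulN1r. Qed.

Lemma sbDr u v w : E w (u + v) = E w u + E w v.
Proof. by rewrite ELC sbDl !(ELC w). Qed.

Lemma sbZr a u w : E w (a *: u) = a * E w u.
Proof. by rewrite ELC sbZl (ELC w). Qed.

Lemma sbNr u w : E w (- u) = - E w u.
Proof. by rewrite ELC sbNl (ELC w). Qed.

Lemma sb_row u w : E u w = \sum_k u 0 k * E (e_ k) w.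
Proof. by apply: (@linear_form_row (E ^~ w)) => a v v'; exact: E_sb.1. Qed.

Definition sbE := (sbDl, sbDr, sbZl, sbZr, sbNl, sbNr).

End SymmetricBilinear.

(** * Identities between a metric [g] and a symmetric tensor [S] *)

Section Metric.
Variables (g S : tensor2).
Hypothesis g_sb : symmetric_bilinear g.
Hypothesis g_unit : gram g \in unitmx.
Hypothesis S_sb : symmetric_bilinear S.

Lemma gramE u w : g u w = (u *m gram g *m w^T) 0 0.
Proof.
rewrite (sb_row g_sb) -mulmxA mxE; apply: eq_bigr => k _; congr (_ * _).
rewrite g_sb.2 (sb_row g_sb) mxE; apply: eq_bigr => j _.
by rewrite !mxE g_sb.2 mulrC.
Qed.

(** Nondegeneracy in the form used below: an equation between vectors may be checked after pairing
    both sides with an arbitrary vector. *)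
Lemma sharpK u : sharp g (g u) = u.
Proof.
rewrite /sharp -[RHS](mulmxK g_unit); congr (_ *m _).
apply/rowP => k; rewrite mxE gramE trmx_delta -colE.
by rewrite !mxE.
Qed.

(** [sharp] reads [alpha] on basis vectors only; linearity extends the equation to every [w]. *)
Lemma sharpP (alpha : V -> R) w :
  (forall a u v, alpha (a *: u + v) = a * alpha u + alpha v) ->
  g (sharp g alpha) w = alpha w.
Proof.
move=> al; rewrite gramE /sharp mulmxKV //.
rewrite [RHS](linear_form_row al) mxE; apply: eq_bigr => k _.
by rewrite !mxE mulrC.
Qed.

Lemma metric_oper2 X Y : g (oper2 g S X) Y = S X Y.
Proof. by rewrite sharpP // => a u v; rewrite !(sbE S_sb). Qed.

(** Both sides equal [g (oper2 g S X) (oper2 g S Y)]. *)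
Lemma square2C X Y : square2 g S X Y = square2 g S Y X.
Proof.
rewrite /square2 S_sb.2 -metric_oper2 g_sb.2 metric_oper2.
exact: S_sb.2.
Qed.

Lemma square2_sb : symmetric_bilinear (square2 g S).
Proof.
split=> [a u v w|u v]; last exact: square2C.
have opE X Y : square2 g S X Y = S (oper2 g S Y) X by rewrite square2C.
by rewrite !opE S_sb.2 S_sb.1 !(S_sb.2 (oper2 g S w)).
Qed.

(** Q(A, .) is a derivation for the Kulkarni-Nomizu product, so Q(S, G) is the product of g with
    Q(S, g) = - Q(g, S), while Q(g, g) = 0. *)
Lemma tachibana_tensorG X1 X2 X3 X4 X Y :
  tachibana S (tensorG g) X1 X2 X3 X4 X Y =
  - tachibana g (kulkarni_nomizu g S) X1 X2 X3 X4 X Y.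
Proof.
rewrite /tachibana /act4 /tensorG /wedge_op /kulkarni_nomizu !fctE !scaleRoE.
(* Symmetry moves [X] and [Y] to the second slot, so that equal values of [g] and [S] become the
   same atom for [field]. *)
rewrite !(sbE g_sb) !(sbE S_sb) !(g_sb.2 X) !(g_sb.2 Y) !(S_sb.2 X) !(S_sb.2 Y).
by field.
Qed.

(** By the derivation property only the factor g contributes, since Q(S, S) = 0; then Q(S, g) = -
    Q(g, S), and S occurs twice in the product of S with itself, whence the factor 1/2. *)
Lemma tachibana_kulkarni_nomizu X1 X2 X3 X4 X Y :
  tachibana S (kulkarni_nomizu g S) X1 X2 X3 X4 X Y =
  - (tachibana g (kulkarni_nomizu S S) X1 X2 X3 X4 X Y / 2).
Proof.
rewrite /tachibana /act4 /wedge_op /kulkarni_nomizu.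
rewrite !(sbE g_sb) !(sbE S_sb) !(g_sb.2 X) !(g_sb.2 Y) !(S_sb.2 X) !(S_sb.2 Y).
by field.
Qed.

Lemma oper4_tensorG : oper4 g (tensorG g) = wedge_op g.
Proof.
apply/funext => X; apply/funext => Y; apply/funext => Z.
rewrite -[RHS]sharpK /oper4; congr sharp; apply/funext => W.
rewrite /tensorG /wedge_op /kulkarni_nomizu !fctE !scaleRoE !(sbE g_sb).
by field.
Qed.

(** The operator is [wedge_op S X Y] plus [wedge_op g X Y] followed by [oper2 g S]. *)
Lemma oper4_kulkarni_nomizu X Y Z : oper4 g (kulkarni_nomizu g S) X Y Z =
  S Y Z *: X + g Y Z *: oper2 g S X - g X Z *: oper2 g S Y - S X Z *: Y.
Proof.
rewrite -[RHS]sharpK /oper4; congr sharp; apply/funext => W.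
rewrite /kulkarni_nomizu !(sbE g_sb) !metric_oper2.
by ring.
Qed.

Lemma dot4_tensorG T : dot4 g (tensorG g) T = tachibana g T.
Proof. by rewrite /dot4 oper4_tensorG. Qed.

(** The endomorphism [wedge_op g X Y] is skew for [g], so as a derivation it annihilates every
    tensor built from [g] alone. *)
Lemma tachibana_tensorG0 X1 X2 X3 X4 X Y :
  tachibana g (tensorG g) X1 X2 X3 X4 X Y = 0.
Proof.
rewrite /tachibana /act4 /tensorG /wedge_op /kulkarni_nomizu !fctE !scaleRoE.
rewrite !(sbE g_sb) !(g_sb.2 X) !(g_sb.2 Y).
by field.
Qed.

(** The product of g and S is skew in its last two arguments, so its operator is skew for [g] and
    annihilates [tensorG g]. *)
Lemma dot4_kulkarni_nomizu_tensorG X1 X2 X3 X4 X Y :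
  dot4 g (kulkarni_nomizu g S) (tensorG g) X1 X2 X3 X4 X Y = 0.
Proof.
rewrite /dot4 /act4 !oper4_kulkarni_nomizu /tensorG /kulkarni_nomizu.
rewrite !fctE !scaleRoE !(sbE g_sb) !metric_oper2.
rewrite !(g_sb.2 _ (oper2 g S _)) !metric_oper2.
rewrite !(g_sb.2 X) !(g_sb.2 Y) !(S_sb.2 X) !(S_sb.2 Y).
by field.
Qed.

(** The derivation kills the factor [g] and acts on [S] alone. There the terms quadratic in the
    values of [S] cancel by symmetry, and Q(g, S^2) is left. *)
Lemma dot4_kulkarni_nomizu X1 X2 X3 X4 X Y :
  dot4 g (kulkarni_nomizu g S) (kulkarni_nomizu g S) X1 X2 X3 X4 X Y =
  tachibana g (kulkarni_nomizu g (square2 g S)) X1 X2 X3 X4 X Y.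
Proof.
rewrite /tachibana /dot4 /act4 !oper4_kulkarni_nomizu /kulkarni_nomizu.
rewrite /wedge_op !(sbE g_sb) !(sbE S_sb) !(sbE square2_sb).
rewrite !(g_sb.2 _ (oper2 g S _)) !metric_oper2 !(S_sb.2 _ (oper2 g S _)).
rewrite -![S (oper2 g S _) _]/(square2 g S _ _).
rewrite !(g_sb.2 X) !(g_sb.2 Y) !(S_sb.2 X) !(S_sb.2 Y).
rewrite !(square2_sb.2 X) !(square2_sb.2 Y).
by ring.
Qed.

End Metric.

(** * Linearity of the two actions in the tensors involved *)

Section Linearity.
Implicit Types (D : V -> V -> V -> V) (T B : tensor4).

Definition multilinear4 T : Prop :=
  [/\ forall a u v X Y Z, T (a *: u + v) X Y Z = a * T u X Y Z + T v X Y Z,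
      forall a u v X Y Z, T X (a *: u + v) Y Z = a * T X u Y Z + T X v Y Z,
      forall a u v X Y Z, T X Y (a *: u + v) Z = a * T X Y u Z + T X Y v Z
    & forall a u v X Y Z, T X Y Z (a *: u + v) = a * T X Y Z u + T X Y Z v].

(* Stated pointwise: unification of the vector space structures of iterated
   function types blows up. *)
Definition lincomb4 T c T1 d T2 : Prop := forall X1 X2 X3 X4,
  T X1 X2 X3 X4 = c * T1 X1 X2 X3 X4 + d * T2 X1 X2 X3 X4.

Lemma multilinear4_lincomb T c T1 d T2 :
  lincomb4 T c T1 d T2 -> multilinear4 T1 -> multilinear4 T2 ->
  multilinear4 T.
Proof.
move=> TE [T1l T1l' T1l'' T1l'''] [T2l T2l' T2l'' T2l'''].
split=> b u v X Y Z; rewrite !TE.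
- by rewrite T1l T2l; ring.
- by rewrite T1l' T2l'; ring.
- by rewrite T1l'' T2l''; ring.
- by rewrite T1l''' T2l'''; ring.
Qed.

Lemma multilinear4_kulkarni_nomizu (E F : tensor2) :
  symmetric_bilinear E -> symmetric_bilinear F ->
  multilinear4 (kulkarni_nomizu E F).
Proof.
move=> EB FB; split=> a u v X Y Z; rewrite /kulkarni_nomizu.
all: by rewrite !(sbE EB) !(sbE FB); ring.
Qed.

Lemma multilinear4_tensorG (g : tensor2) :
  symmetric_bilinear g -> multilinear4 (tensorG g).
Proof.
(* The second summand is a dummy with coefficient 0. *)
move=> g_sb; apply: (@multilinear4_lincomb _ 2^-1 (kulkarni_nomizu g g)
  0 (kulkarni_nomizu g g)); [|exact: multilinear4_kulkarni_nomizu..].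
by move=> X1 X2 X3 X4; rewrite mul0r addr0.
Qed.

Lemma act4_lincomb D T c T1 d T2 X1 X2 X3 X4 X Y :
  lincomb4 T c T1 d T2 ->
  act4 D T X1 X2 X3 X4 X Y =
  c * act4 D T1 X1 X2 X3 X4 X Y + d * act4 D T2 X1 X2 X3 X4 X Y.
Proof. by move=> TE; rewrite /act4 !TE; ring. Qed.

Lemma sharp_lincomb (g : tensor2) (al al1 al2 : V -> R) (c d : R) :
  (forall u, al u = c * al1 u + d * al2 u) ->
  sharp g al = c *: sharp g al1 + d *: sharp g al2.
Proof.
move=> alE; rewrite /sharp !scalemxAl -mulmxDl; congr (_ *m _).
by apply/rowP => k; rewrite !mxE alE.
Qed.

(** [B] enters through a vector inserted into one slot of [T], so linearity in [B] rests on
    linearity of [T] in each slot. *)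
Lemma dot4_lincomb (g : tensor2) B c B1 d B2 T X1 X2 X3 X4 X Y :
  lincomb4 B c B1 d B2 -> multilinear4 T ->
  dot4 g B T X1 X2 X3 X4 X Y =
  c * dot4 g B1 T X1 X2 X3 X4 X Y + d * dot4 g B2 T X1 X2 X3 X4 X Y.
Proof.
move=> BE [T1 T2 T3 T4].
have opE U1 U2 U3 : oper4 g B U1 U2 U3 =
    c *: oper4 g B1 U1 U2 U3 + d *: oper4 g B2 U1 U2 U3.
  by apply: sharp_lincomb => u; exact: BE.
rewrite /dot4 /act4 !opE.
rewrite (@linear_form_lincomb (fun u => T u X2 X3 X4));
  last by move=> *; exact: T1.
rewrite (@linear_form_lincomb (fun u => T X1 u X3 X4));
  last by move=> *; exact: T2.
rewrite (@linear_form_lincomb (fun u => T X1 X2 u X4));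
  last by move=> *; exact: T3.
rewrite (@linear_form_lincomb (fun u => T X1 X2 X3 u));
  last by move=> *; exact: T4.
by ring.
Qed.

End Linearity.

(** * The identity for the Weyl tensor, in pure tensor algebra *)

Section WeylIdentity.
Variables (g S : tensor2) (Rm : tensor4) (kappa : R).
Hypothesis g_sb : symmetric_bilinear g.
Hypothesis g_unit : gram g \in unitmx.
Hypothesis S_sb : symmetric_bilinear S.
Hypothesis Rm_ml : multilinear4 Rm.
Hypothesis n_gt2 : (2 < n)%N.

Let a : R := (n%:R - 2)^-1.
Let b : R := kappa / ((n%:R - 2) * (n%:R - 1)).
Local Notation K := (kulkarni_nomizu g S).
Local Notation G := (tensorG g).
(* [A = Rm - W] for the Weyl tensor [W]. *)
Let A : tensor4 := fun X1 X2 X3 X4 =>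
  a * K X1 X2 X3 X4 + (- b) * G X1 X2 X3 X4.

Let AE : lincomb4 A a K (- b) G. Proof. by []. Qed.

Let K_ml : multilinear4 K.
Proof. exact: multilinear4_kulkarni_nomizu. Qed.

Let G_ml : multilinear4 G. Proof. exact: multilinear4_tensorG. Qed.

Let A_ml : multilinear4 A.
Proof. exact: multilinear4_lincomb AE K_ml G_ml. Qed.

(** [A] is the product of g with the Schouten tensor. Of the four terms, K.G and G.G vanish, K.K
    gives the part with S^2, and G.K = Q(g, K) carries the coefficient - a b. *)
Lemma dot4_schouten X1 X2 X3 X4 X Y : dot4 g A A X1 X2 X3 X4 X Y =
  a ^+ 2 * tachibana g (kulkarni_nomizu g (square2 g S)) X1 X2 X3 X4 X Y
  - a * b * tachibana g K X1 X2 X3 X4 X Y.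
Proof.
rewrite (dot4_lincomb _ _ _ _ _ _ _ AE A_ml) /dot4.
rewrite !(act4_lincomb _ _ _ _ _ _ _ AE).
rewrite -!/(dot4 g _ _ _ _ _ _ _ _) dot4_kulkarni_nomizu //.
rewrite dot4_kulkarni_nomizu_tensorG // !dot4_tensorG // tachibana_tensorG0 //.
by ring.
Qed.

Lemma tachibana_schouten X1 X2 X3 X4 X Y : tachibana S A X1 X2 X3 X4 X Y =
  - (a / 2) * tachibana g (kulkarni_nomizu S S) X1 X2 X3 X4 X Y
  + b * tachibana g K X1 X2 X3 X4 X Y.
Proof.
rewrite /tachibana (act4_lincomb _ _ _ _ _ _ _ AE).
rewrite -!/(tachibana _ _ _ _ _ _ _ _).
rewrite tachibana_kulkarni_nomizu // tachibana_tensorG //.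
by ring.
Qed.

(** [W] stands for the Weyl tensor and [Z] for the tensor inside the last Q(g, .); both are given by
    pointwise equations, as in [lincomb4]. *)
Lemma weyl_curvature_identity (L LC : R) (W Z : tensor4) :
  (forall X1 X2 X3 X4, W X1 X2 X3 X4 =
     Rm X1 X2 X3 X4 - a * K X1 X2 X3 X4 + b * G X1 X2 X3 X4) ->
  (forall X1 X2 X3 X4, Z X1 X2 X3 X4 =
     (n%:R - 2) / 2 * kulkarni_nomizu S S X1 X2 X3 X4 - kappa * K X1 X2 X3 X4
     + kulkarni_nomizu g (square2 g S) X1 X2 X3 X4) ->
  (forall X1 X2 X3 X4 X Y,
     dot4 g Rm Rm X1 X2 X3 X4 X Y - tachibana S Rm X1 X2 X3 X4 X Y
     = L * tachibana g W X1 X2 X3 X4 X Y) ->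
  (forall X1 X2 X3 X4 X Y, dot4 g W W X1 X2 X3 X4 X Y
     = LC * tachibana g W X1 X2 X3 X4 X Y) ->
  forall X1 X2 X3 X4 X Y,
  dot4 g W Rm X1 X2 X3 X4 X Y + dot4 g Rm W X1 X2 X3 X4 X Y
  = tachibana S W X1 X2 X3 X4 X Y + (L + LC) * tachibana g W X1 X2 X3 X4 X Y
    - ((n%:R - 2) ^+ 2)^-1 * tachibana g Z X1 X2 X3 X4 X Y.
Proof.
move=> W_def Z_def hL hLC X1 X2 X3 X4 X Y.
have WE : lincomb4 W 1 Rm (-1) A.
  by move=> Y1 Y2 Y3 Y4; rewrite W_def /A; ring.
have W_ml : multilinear4 W by exact: multilinear4_lincomb WE Rm_ml A_ml.
pose Z1 : tensor4 := fun X1 X2 X3 X4 =>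
  ((n%:R - 2) / 2) * kulkarni_nomizu S S X1 X2 X3 X4
  + (- kappa) * K X1 X2 X3 X4.
have ZE : lincomb4 Z 1 Z1 1 (kulkarni_nomizu g (square2 g S)).
  by move=> Y1 Y2 Y3 Y4; rewrite Z_def /Z1; ring.
have Z1E : lincomb4 Z1 ((n%:R - 2) / 2) (kulkarni_nomizu S S) (- kappa) K by [].
have tZ : tachibana g Z X1 X2 X3 X4 X Y =
    (n%:R - 2) / 2 * tachibana g (kulkarni_nomizu S S) X1 X2 X3 X4 X Y
    - kappa * tachibana g K X1 X2 X3 X4 X Y
    + tachibana g (kulkarni_nomizu g (square2 g S)) X1 X2 X3 X4 X Y.
  rewrite /tachibana (act4_lincomb _ _ _ _ _ _ _ ZE).
  by rewrite (act4_lincomb _ _ _ _ _ _ _ Z1E); ring.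
have dW B : dot4 g B W X1 X2 X3 X4 X Y =
    dot4 g B Rm X1 X2 X3 X4 X Y - dot4 g B A X1 X2 X3 X4 X Y.
  by rewrite /dot4 (act4_lincomb _ _ _ _ _ _ _ WE); ring.
have tW : tachibana S W X1 X2 X3 X4 X Y =
    tachibana S Rm X1 X2 X3 X4 X Y - tachibana S A X1 X2 X3 X4 X Y.
  by rewrite /tachibana (act4_lincomb _ _ _ _ _ _ _ WE); ring.
have {hL} := hL X1 X2 X3 X4 X Y; have {hLC} := hLC X1 X2 X3 X4 X Y.
rewrite tZ tW !dW (dot4_lincomb _ _ _ _ _ _ _ WE Rm_ml).
rewrite (dot4_lincomb _ _ _ _ _ _ _ WE A_ml) dot4_schouten tachibana_schouten.
(* Trading both multiples of Q(g, W) for their left-hand sides eliminates [W]. The mixed terms Rm.A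
   and A.Rm then cancel, and a rational identity in [n] and [kappa] remains. *)
set tgW := tachibana g W _ _ _ _ _ _; rewrite mulrDl => <- <-.
have n2_neq0 : n%:R - 2 != 0 :> R.
  by rewrite subr_eq0 eqr_nat gtn_eqF.
have n1_neq0 : n%:R - 1 != 0 :> R.
  by rewrite subr_eq0 (eqr_nat R n 1) gtn_eqF // ltnW.
rewrite /a /b; field.
by rewrite n2_neq0 n1_neq0.
Qed.

End WeylIdentity.

End CurvatureAlgebra.

(** * Mixed second derivatives *)

Section SecondDerivatives.
Context {R : realType} {V : normedModType R}.
Implicit Types (f : V -> R) (x y u v : V).

(** Restriction to a line, which makes the one-variable mean value theorem applicable. *)
Lemma is_derive_line f y u (s d : R) : is_derive (s *: u + y) u f d ->
  is_derive s 1 (fun h : R => f (h *: u + y)) d.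
Proof.
have E : (fun h : R =>
      h^-1 *: (((fun k : R => f (k *: u + y)) \o shift s) (h *: 1)
               - f (s *: u + y))) =
    (fun h => h^-1 *: ((f \o shift (s *: u + y)) (h *: u) - f (s *: u + y))).
  apply/funext => h /=; congr (_ *: (f _ - _)).
  by rewrite [h *: 1]mulr1 scalerDl addrA.
move=> [df <-]; apply: DeriveDef; first by rewrite /derivable E.
by rewrite /derive E.
Qed.

Lemma differentiable_le f x (e : R) : differentiable f x -> 0 < e ->
  \forall h \near (0 : V), `|f (h + x) - f x - 'd f x h| <= e * `|h|.
Proof.
move=> /diff_locally df e0.
have /eqaddoP/(_ e e0) := df.
apply: filterS => h /=; congr (`| _ | <= _).
by rewrite !fctE opprD addrA.
Qed.

(** The second difference is the increment over [0, t] of [phi], the difference of [f] along two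
    parallel segments; the mean value theorem applies to [phi]. *)
Lemma second_difference_mvt f f' x u v (t : R) : 0 < t ->
  (forall s, s \in `[0, t]%R ->
     is_derive (s *: u + (t *: v + x)) u f (f' (s *: u + (t *: v + x)))) ->
  (forall s, s \in `[0, t]%R -> is_derive (s *: u + x) u f (f' (s *: u + x))) ->
  exists2 s, s \in `[0, t]%R &
    f (t *: u + (t *: v + x)) - f (t *: u + x) - f (t *: v + x) + f x =
    t * (f' (s *: u + (t *: v + x)) - f' (s *: u + x)).
Proof.
move=> t0 df1 df2.
pose phi : R -> R := fun s => f (s *: u + (t *: v + x)) - f (s *: u + x).
pose dphi : R -> R := fun s => f' (s *: u + (t *: v + x)) - f' (s *: u + x).
have oo_cc s : s \in `]0, t[%R -> s \in `[0, t]%R.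
  by rewrite !in_itv /= => /andP[s0 st]; rewrite !ltW.
have phiD s : s \in `[0, t]%R -> is_derive s 1 phi (dphi s).
  move=> s_in; apply: is_deriveB; apply: is_derive_line; first exact: df1.
  exact: df2.
have phi_cont : {within `[0, t], continuous phi}.
  by apply: derivable_within_continuous => s /phiD [].
have [s /oo_cc s_in phiE] :=
  MVT t0 (fun s s_in => phiD s (oo_cc s s_in)) phi_cont.
exists s => //; rewrite -/(dphi s) mulrC -[X in _ * X]subr0 -phiE /phi.
by rewrite !scale0r !add0r; ring.
Qed.

(** The mean value theorem gives [t] times an increment of [f'] between two points near [x].
    Expanding [f'] to first order at [x] for both points, the parts along [u] cancel and
    [t * 'D_v f' x] is left. *)
Lemma second_difference f f' x u v (e : R) : 0 < e ->
  (\forall y \near x, is_derive y u f (f' y)) -> differentiable f' x ->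
  \forall t \near 0^'+,
    `|f (t *: u + (t *: v + x)) - f (t *: u + x) - f (t *: v + x) + f x
      - t ^+ 2 * 'D_v f' x| <= e * t ^+ 2.
Proof.
move=> e0 df ddf; pose c := `|u| + `|v|.
have c0 : 0 <= c by rewrite addr_ge0.
(* Two expansion errors of size [e' * (t * c)] must add up to at most [e * t]; the summand 1 keeps
   the denominator positive when [c] is 0. *)
pose e' := e / (2 * c + 1).
have e'0 : 0 < e' by rewrite divr_gt0 // ltr_wpDl // mulr_ge0.
have := differentiable_le ddf e'0; move/nbhs_ballP => [d1 /= d10 B1].
move/nbhs_ballP : df => [d2 /= d20 B2].
near=> t.
have t0 : 0 < t by near: t; exact: nbhs_right_gt.
(* This keeps the whole parallelogram inside both balls; [c + 1] replaces [c] to allow the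
   division. *)
have tc : t * c < Num.min d1 d2.
  have : t * (c + 1) < Num.min d1 d2.
    rewrite -ltr_pdivlMr ?ltr_wpDl //; near: t; apply: nbhs_right_lt.
    by rewrite divr_gt0 ?ltr_wpDl // lt_min d10 d20.
  by apply: le_lt_trans; rewrite ler_pM2l // lerDl.
have nrm a b : a \in `[0, t]%R -> b \in `[0, t]%R ->
    `|a *: u + b *: v| <= t * c.
  rewrite !in_itv /= => /andP[a0 at_] /andP[b0 bt].
  rewrite (le_trans (ler_normD _ _)) // !normrZ !ger0_norm //.
  by rewrite /c mulrDr lerD // ler_wpM2r.
have t_in : t \in `[0, t]%R by rewrite in_itv /= lexx ltW.
have z_in : 0 \in `[0, t]%R by rewrite in_itv /= lexx ltW.
have dfab a b : a \in `[0, t]%R -> b \in `[0, t]%R ->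
    is_derive (a *: u + (b *: v + x)) u f (f' (a *: u + (b *: v + x))).
  move=> ain bin; apply: B2; rewrite -ball_normE /= distrC addrA addrK.
  rewrite (le_lt_trans (nrm _ _ ain bin)) // (lt_le_trans tc) //.
  by rewrite ge_min lexx orbT.
have dgab a b : a \in `[0, t]%R -> b \in `[0, t]%R ->
    `|f' (a *: u + (b *: v + x)) - f' x - 'd f' x (a *: u + b *: v)|
    <= e' * (t * c).
  move=> ain bin; rewrite addrA (le_trans (B1 _ _)) //; last first.
    by rewrite ler_pM2l // nrm.
  rewrite -ball_normE /= sub0r normrN.
  by rewrite (le_lt_trans (nrm _ _ ain bin)) // (lt_le_trans tc) // ge_min lexx.
have dfa0 s : s \in `[0, t]%R -> is_derive (s *: u + x) u f (f' (s *: u + x)).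
  by move=> s_in; have := dfab s 0 s_in z_in; rewrite scale0r add0r.
have [s s_in ->] :=
  second_difference_mvt t0 (fun s s_in => dfab s t s_in t_in) dfa0.
have /ler_normlP[lo1 up1] := dgab s t s_in t_in.
have /ler_normlP := dgab s 0 s_in z_in.
rewrite scale0r add0r addr0 => -[lo2 up2].
have dE : 'd f' x (s *: u + t *: v) = 'd f' x (s *: u) + t * 'D_v f' x.
  by rewrite deriveE // linearD (linearZ _ v).
set dphi := f' (s *: u + (t *: v + x)) - f' (s *: u + x).
have -> : t * dphi - t ^+ 2 * 'D_v f' x = t * (dphi - t * 'D_v f' x) by ring.
rewrite normrM gtr0_norm // expr2 mulrCA ler_pM2l //.
apply: (@le_trans _ _ (2 * (e' * (t * c)))).
  by apply/ler_normlP; rewrite /dphi; split; lra.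
have -> : 2 * (e' * (t * c)) = t * (e * (2 * c / (2 * c + 1))).
  by rewrite /e'; ring.
have c21 : 0 < 2 * c + 1 by rewrite ltr_wpDl // mulr_ge0.
have q1 : 2 * c / (2 * c + 1) <= 1 by rewrite ler_pdivrMr // mul1r lerDl.
by rewrite [X in _ <= X]mulrC ler_pM2l // ler_piMr // ltW.
Unshelve. all: by end_near. Qed.

Lemma ler_dist_quot (d t a b e : R) : 0 < t ->
  `|d - t * a| <= e / 2 * t -> `|d - t * b| <= e / 2 * t -> `|a - b| <= e.
Proof.
move=> t0 /ler_normlP[lo1 up1] /ler_normlP[lo2 up2].
rewrite -(ler_pM2l t0) -{1}(gtr0_norm t0) -normrM mulrBr.
by apply/ler_normlP; split; lra.
Qed.

(** The second difference of [f] is symmetric in [u] and [v], and [t ^+ 2] times either mixed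
    derivative approximates it up to o(t^2). *)
Lemma derive_commute f fu fv x u v :
  (\forall y \near x, is_derive y u f (fu y)) ->
  (\forall y \near x, is_derive y v f (fv y)) ->
  differentiable fu x -> differentiable fv x ->
  'D_v fu x = 'D_u fv x.
Proof.
move=> dfu dfv ddfu ddfv; apply/eqP; rewrite -subr_eq0 -normr_le0.
apply/ler_addgt0Pl => e e0; rewrite addr0.
have e20 : 0 < e / 2 by rewrite divr_gt0.
have [t [t0 [du dv]]] := filter_ex (filterI (nbhs_right_gt (0 : R))
  (filterI (second_difference v e20 dfu ddfu)
    (second_difference u e20 dfv ddfv))).
have t20 : 0 < t ^+ 2 by rewrite exprn_gt0.
apply: (ler_dist_quot t20 du).
by move: dv; rewrite [t *: v + (t *: u + x)]addrCA (addrAC (f _)).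
Qed.

End SecondDerivatives.

(** * Derivatives of sums, determinants, inverse matrices and inner products *)

Section DerivableMatrix.
Context {R : realType} {V : normedModType R}.
Implicit Types (x v : V).

Lemma derivable_fsum (I : finType) (P : pred I) (h : I -> V -> R) x v :
  (forall i, P i -> derivable (h i) x v) ->
  derivable (fun y => \sum_(i | P i) h i y) x v.
Proof.
move=> dh; rewrite -fct_sumE.
apply: (big_ind (fun f => derivable f x v)) => [|f1 f2 df1 df2|i Pi].
- exact: (derivable_cst (0 : R) x v).
- exact: (derivableD df1 df2).
- exact: dh.
Qed.

Lemma derivable_fprod (I : finType) (P : pred I) (h : I -> V -> R) x v :
  (forall i, P i -> derivable (h i) x v) ->
  derivable (fun y => \prod_(i | P i) h i y) x v.
Proof.
move=> dh.
have -> : (fun y => \prod_(i | P i) h i y) = \prod_(i | P i) h i.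
  by apply/funext => y; elim/big_rec2 : _ => // i a f _ ->.
apply: (big_ind (fun f => derivable f x v)) => [|f1 f2 df1 df2|i Pi].
- exact: (derivable_cst (1 : R) x v).
- exact: (derivableM df1 df2).
- exact: dh.
Qed.

Lemma derive_fsum (I : finType) (h : I -> V -> R) x v :
  (forall i, derivable (h i) x v) ->
  'D_v (fun y => \sum_i h i y) x = \sum_i 'D_v (h i) x.
Proof.
move=> dh; rewrite -fct_sumE.
suff : is_derive x v (\sum_i h i) (\sum_i 'D_v (h i) x) by case.
elim/big_ind2 : _ => //.
- exact: is_derive_cst.
- by move=> f1 g1 f2 g2 d1 d2; exact: is_deriveD.
Qed.

Lemma derivable_det m (A : V -> 'M[R]_m) x v :
  (forall i j, derivable (fun y => A y i j) x v) ->
  derivable (fun y => \det (A y)) x v.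
Proof.
move=> dA; rewrite /determinant; apply: derivable_fsum => s _.
apply: derivableM; first exact: derivable_cst.
by apply: derivable_fprod => i _; exact: dA.
Qed.

(** By Cramer's rule, near [x] an entry of the inverse is a cofactor divided by the determinant. *)
Lemma derivable_invmx m (A : V -> 'M[R]_m) x v i j :
  (\forall y \near x, A y \in unitmx) ->
  (forall i j, derivable (fun y => A y i j) x v) ->
  derivable (fun y => invmx (A y) i j) x v.
Proof.
move=> Au dA.
apply: (@near_eq_derivable _ _ _
  (fun y => (\det (A y))^-1
    * ((-1) ^+ (j + i) * \det (row' j (col' i (A y)))))).
  near=> y; have yu : A y \in unitmx by near: y.
  by rewrite /invmx yu !mxE.
apply: derivableM.
  apply: derivableV; last exact: derivable_det.
  by have := nbhs_singleton Au; rewrite unitmxE unitfE.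
apply: derivableM; first exact: derivable_cst.
apply: derivable_det => k l.
have -> : (fun y => row' j (col' i (A y)) k l) =
  (fun y => A y (lift j k) (lift i l)) by apply/funext => y; rewrite !mxE.
exact: dA.
Unshelve. all: by end_near. Qed.

Lemma derive_entry m n (A : V -> 'M[R]_(m, n)) x v i j : derivable A x v ->
  'D_v (fun y => A y i j) x = ('D_v A x) i j.
Proof. by move=> dA; rewrite derive_mx // mxE. Qed.

Lemma derivable_entry m n (A : V -> 'M[R]_(m, n)) x v i j :
  derivable A x v -> derivable (fun y => A y i j) x v.
Proof. by move=> /derivable_mxP. Qed.

Lemma is_derive_edot N (A B : V -> 'rV[R]_N) x v :
  derivable A x v -> derivable B x v ->
  is_derive x v (fun y => edot (A y) (B y))
    (edot ('D_v A x) (B x) + edot (A x) ('D_v B x)).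
Proof.
move=> dA dB; have dM k : is_derive x v (fun y => A y 0 k * B y 0 k)
    (('D_v A x) 0 k * B x 0 k + A x 0 k * ('D_v B x) 0 k).
  rewrite addrC [_ * B x 0 k]mulrC -!(@derive_entry _ _ _ x v) //.
  by apply: is_deriveM; apply: DeriveDef => //; exact: derivable_entry.
apply: DeriveDef.
  by apply: derivable_fsum => k _; case: (dM k).
rewrite derive_fsum; last by move=> k; case: (dM k).
by rewrite -big_split; apply: eq_bigr => k _; case: (dM k).
Qed.

End DerivableMatrix.

(** * The Gauss equation *)

Section EuclideanProduct.
Context {R : realType} {N : nat}.

Lemma edot_sb : @symmetric_bilinear R N (@edot R N).
Proof.
split=> [a u v w|u v].
  rewrite /edot mulr_sumr -big_split; apply: eq_bigr => k _.
  by rewrite !mxE /=; ring.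
by apply: eq_bigr => k _; rewrite mulrC.
Qed.

Lemma edot_eq0 (a : 'rV[R]_N) : edot a a = 0 -> a = 0.
Proof.
move=> /eqP; rewrite psumr_eq0 => [/allP a0|k _]; last first.
  by rewrite -expr2 sqr_ge0.
apply/rowP => k; rewrite mxE; apply/eqP.
by have := a0 k (mem_index_enum k); rewrite mulf_eq0 orbb.
Qed.

End EuclideanProduct.


Section GaussEquation.
Context {R : realType} {n N : nat}.
Local Notation V := 'rV[R]_n.
Local Notation E := 'rV[R]_N.
Local Notation e_ i := (delta_mx (0 : 'I_1) i : V).
(* [F1 v] and [F2 u v] stand for the derivatives ['D_v F] and ['D_u ('D_v F)]
   of the immersion; they are abstract because unifying two distinct such
   derivatives unfolds them down to filters. *)
Variables (U : set V) (F1 : V -> V -> E) (F2 : V -> V -> V -> E).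
Variable g : V -> V -> V -> R^o.
Hypothesis U_open : open U.
Hypothesis gE : forall y u v, g y u v = edot (F1 u y) (F1 v y).
Hypothesis F1P : forall a u v y, U y ->
  F1 (a *: u + v) y = a *: F1 u y + F1 v y.
Hypothesis F1_inj : forall u y, U y -> F1 u y = 0 -> u = 0.
Hypothesis F1_derive : forall u v y, U y -> is_derive y u (F1 v) (F2 u v y).
Hypothesis F2P : forall a u v w y, U y ->
  F2 (a *: u + v) w y = a *: F2 u w y + F2 v w y.
Hypothesis F2C : forall u v y, U y -> F2 u v y = F2 v u y.
Hypothesis F2_derivable : forall u v w y, U y -> derivable (F2 v w) y u.
Hypothesis F3C : forall u v w y, U y -> 'D_u (F2 v w) y = 'D_v (F2 u w) y.
Implicit Types (x y u v w z : V).

Let near_U x : U x -> \forall y \near x, U y.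
Proof. by move=> Ux; exact: open_nbhs_nbhs. Qed.

Let edotC := (@edot_sb R N).2.
Let edotP := (@edot_sb R N).1.

Lemma F2Pr a u v w y : U y ->
  F2 w (a *: u + v) y = a *: F2 w u y + F2 w v y.
Proof.
by move=> Uy; rewrite (F2C _ _ Uy) F2P // (F2C u w Uy) (F2C v w Uy).
Qed.

Lemma metric_sb y : U y -> symmetric_bilinear (g y).
Proof.
move=> Uy; split=> [a u v w|u v]; last by rewrite !gE edotC.
by rewrite !gE F1P // edotP.
Qed.

(** A vector [u] in the kernel of the Gram matrix satisfies g(u, u) = 0, so [F1 u y] has zero length
    and [u] vanishes by injectivity of the differential. *)
Lemma metric_unit y : U y -> gram (g y) \in unitmx.
Proof.
move=> Uy; rewrite -row_free_unit -kermx_eq0; apply/eqP/row_matrixP => i.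
rewrite row0; set u := row i _.
have uG : u *m gram (g y) = 0 by apply/eqP; rewrite -sub_kermx row_sub.
have : g y u u = 0 by rewrite (gramE (metric_sb Uy)) uG mul0mx mxE.
by rewrite gE => /edot_eq0; exact: F1_inj.
Qed.

Lemma F1_derivable v u y : U y -> derivable (F1 v) y u.
Proof. by move=> Uy; case: (F1_derive u v Uy). Qed.

Lemma is_derive_metric u v w y : U y ->
  is_derive y u (fun z => g z v w)
    (edot (F2 u v y) (F1 w y) + edot (F1 v y) (F2 u w y)).
Proof.
move=> Uy.
have -> : (fun z => g z v w) = (fun z => edot (F1 v z) (F1 w z)).
  by apply/funext => z; exact: gE.
have [dv <-] := F1_derive u v Uy; have [dw <-] := F1_derive u w Uy.
exact: is_derive_edot.
Qed.

(** Each metric derivative in the Koszul formula splits in two by the product rule. By symmetry of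
    [F2], four of the six terms cancel and the other two coincide. *)
Lemma christoffelE u v y : U y ->
  christoffel g y u v = sharp (g y) (fun w => edot (F2 u v y) (F1 w y)).
Proof.
move=> Uy; rewrite /christoffel; congr (sharp _ _); apply/funext => w.
transitivity (2^-1 * ((edot (F2 u v y) (F1 w y) + edot (F1 v y) (F2 u w y))
  + (edot (F2 v u y) (F1 w y) + edot (F1 u y) (F2 v w y))
  - (edot (F2 w u y) (F1 v y) + edot (F1 u y) (F2 w v y)))).
  congr (_ * (_ + _ - _)).
  - exact: (@derive_val _ _ _ _ _ _ _ (is_derive_metric u v w Uy)).
  - exact: (@derive_val _ _ _ _ _ _ _ (is_derive_metric v u w Uy)).
  - exact: (@derive_val _ _ _ _ _ _ _ (is_derive_metric w u v Uy)).
rewrite (F2C v u Uy) (F2C w u Uy) (F2C w v Uy) (edotC (F2 u w y)).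
by field.
Qed.

(** Geometrically, [F1] of the Christoffel vector is the tangential part of [F2 u v y]. *)
Lemma metric_christoffel u v w y : U y ->
  g y (christoffel g y u v) w = edot (F2 u v y) (F1 w y).
Proof.
move=> Uy; rewrite christoffelE // (sharpP (metric_sb Uy) (metric_unit Uy)) //.
by move=> a z z'; rewrite F1P // edotC edotP !(edotC _ (F2 u v y)).
Qed.

Lemma derivable_christoffel u v w y : U y ->
  derivable (fun z => christoffel g z u v) y w.
Proof.
move=> Uy; apply: (@near_eq_derivable _ _ _
  (fun z => sharp (g z) (fun w' => edot (F2 u v z) (F1 w' z)))).
  by apply: filterS (near_U Uy) => z Uz; rewrite christoffelE.
apply/derivable_mxP => i j; rewrite ord1.
have -> : (fun z => sharp (g z) (fun w' => edot (F2 u v z) (F1 w' z)) 0 j) =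
    (fun z => \sum_k edot (F2 u v z) (F1 (e_ k) z) * invmx (gram (g z)) k j).
  by apply/funext => z; rewrite mxE; apply: eq_bigr => k _; rewrite mxE.
apply: derivable_fsum => k _; apply: derivableM.
  have := @F2_derivable w u v y Uy; have := @F1_derivable (e_ k) w y Uy.
  by move=> d1 d2; case: (is_derive_edot d2 d1).
apply: derivable_invmx => [|i' j'].
  by apply: filterS (near_U Uy) => z; exact: metric_unit.
have -> : (fun z => gram (g z) i' j') = (fun z => g z (e_ i') (e_ j')).
  by apply/funext => z; rewrite mxE.
by case: (is_derive_metric w (e_ i') (e_ j') Uy).
Qed.

(* This is [g(christoffel v w, z) = <F2 v w, F1 z>] differentiated along [u]. *)
Lemma metric_nabla_nabla u v w z x : U x ->
  g x ('D_u (fun y => christoffel g y v w) x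
       + christoffel g x u (christoffel g x v w)) z =
  edot ('D_u (F2 v w) x) (F1 z x)
  + edot (F2 v w x - F1 (christoffel g x v w) x) (F2 u z x).
Proof.
move=> Ux; set a := christoffel g x v w; pose A y := christoffel g y v w.
have dA : derivable A x u by exact: derivable_christoffel.
(* Expanding in the basis separates the moving vector [A y] from the moving metric, so that the
   scalar product rule applies to each term. *)
have Ag y : U y -> \sum_k A y 0 k * g y (e_ k) z = edot (F2 v w y) (F1 z y).
  by move=> Uy; rewrite -(sb_row (metric_sb Uy)) metric_christoffel.
have dL k : is_derive x u (fun y => A y 0 k * g y (e_ k) z)
    (('D_u A x) 0 k * g x (e_ k) z
     + a 0 k * (edot (F2 u (e_ k) x) (F1 z x) + edot (F1 (e_ k) x) (F2 u z x))).
  rewrite addrC [_ * g x _ _]mulrC -(derive_entry 0 k dA).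
  apply: is_deriveM; last exact: is_derive_metric.
  by apply: DeriveDef => //; exact: derivable_entry.
have dR : is_derive x u (fun y => edot (F2 v w y) (F1 z y))
    (edot ('D_u (F2 v w) x) (F1 z x) + edot (F2 v w x) (F2 u z x)).
  have [dz <-] := F1_derive u z Ux.
  exact: is_derive_edot (@F2_derivable u v w x Ux) dz.
have LR : 'D_u (fun y => \sum_k A y 0 k * g y (e_ k) z) x =
    edot ('D_u (F2 v w) x) (F1 z x) + edot (F2 v w x) (F2 u z x).
  case: dR => _ <-; apply: near_eq_derive.
  by apply: filterS (near_U Ux) => y; exact: Ag.
have : \sum_k (('D_u A x) 0 k * g x (e_ k) z
     + a 0 k * (edot (F2 u (e_ k) x) (F1 z x)
                + edot (F1 (e_ k) x) (F2 u z x))) =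
    edot ('D_u (F2 v w) x) (F1 z x) + edot (F2 v w x) (F2 u z x).
  rewrite -LR derive_fsum => [|k]; last by case: (dL k).
  by apply: eq_bigr => k _; case: (dL k).
(* The metric is differentiated with the vector frozen at [a]. The first term is the pairing of
   [christoffel g x u a] with [z]; the second supplies the correction by [F1 a] on the right. *)
have BE : \sum_k a 0 k * (edot (F2 u (e_ k) x) (F1 z x)
      + edot (F1 (e_ k) x) (F2 u z x)) =
    edot (F2 u a x) (F1 z x) + edot (F1 a x) (F2 u z x).
  apply/esym/(@linear_form_row _ _ (fun a' : V =>
    edot (F2 u a' x) (F1 z x) + edot (F1 a' x) (F2 u z x))) => b v1 v2.
  by rewrite F2Pr // F1P // !edotP; ring.
rewrite big_split /= -(sb_row (metric_sb Ux)) BE => HE.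
rewrite (sbDl (metric_sb Ux)) metric_christoffel //.
rewrite (sbDl edot_sb) (sbNl edot_sb) addrA -HE.
by rewrite /A; ring.
Qed.

(** The second fundamental form by the Gauss formula, expressed with the abstract derivatives. *)
Definition normal_hess x u v : E := F2 u v x - F1 (christoffel g x u v) x.

Lemma christoffelC x u v : U x -> christoffel g x u v = christoffel g x v u.
Proof.
move=> Ux; apply: (can_inj (sharpK (metric_sb Ux) (metric_unit Ux))).
have GE a b c := @metric_christoffel a b c x Ux.
move: (christoffel g x) GE => G GE.
by apply/funext => z; rewrite !GE (F2C _ _ Ux).
Qed.

Lemma christoffelP x a u v w : U x -> christoffel g x (a *: u + v) w =
  a *: christoffel g x u w + christoffel g x v w.
Proof.
move=> Ux; apply: (can_inj (sharpK (metric_sb Ux) (metric_unit Ux))).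
have GE b c d := @metric_christoffel b c d x Ux.
move: (christoffel g x) GE => G GE.
by apply/funext => z; rewrite (metric_sb Ux).1 !GE (F2P _ _ _ _ Ux) edotP.
Qed.

Lemma normal_hessC x u v : U x -> normal_hess x u v = normal_hess x v u.
Proof.
by move=> Ux; rewrite /normal_hess (F2C _ _ Ux) (christoffelC _ _ Ux).
Qed.

Lemma normal_hessP x a u v w : U x -> normal_hess x (a *: u + v) w =
  a *: normal_hess x u w + normal_hess x v w.
Proof.
move=> Ux; rewrite /normal_hess (christoffelP _ _ _ _ Ux).
move: (christoffel g x) => G.
by rewrite (F2P _ _ _ _ Ux) (F1P _ _ _ Ux) scalerBr opprD addrACA.
Qed.

Lemma normal_hess_orth x u v z : U x -> edot (normal_hess x u v) (F1 z x) = 0.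
Proof.
move=> Ux; rewrite /normal_hess (sbDl edot_sb) (sbNl edot_sb) -gE.
by rewrite (metric_christoffel _ _ _ Ux) subrr.
Qed.

(** For fields with constant components the bracket vanishes and the first covariant derivative is
    the Christoffel term alone. *)
Lemma curv_opE x u v w :  U x -> curv_op g x u v w =
  ('D_u (fun y => christoffel g y v w) x
   + christoffel g x u (christoffel g x v w))
  - ('D_v (fun y => christoffel g y u w) x
     + christoffel g x v (christoffel g x u w)).
Proof.
move=> Ux; rewrite /curv_op /curv_field.
have nablaC a : nabla g (fun=> a) (fun=> w) = fun y => christoffel g y a w.
  by apply/funext => y; rewrite /nabla derive_cst add0r.
have bracket0 : lie_bracket (fun=> u) (fun=> v) = fun=> 0.
  by apply/funext => y; rewrite /lie_bracket !derive_cst subr0.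
rewrite !nablaC bracket0 nablaC.
(* This is the bracket term; it vanishes because [F2 0 w] is a derivative in the direction 0. *)
have -> : christoffel g x 0 w = 0.
  apply: (can_inj (sharpK (metric_sb Ux) (metric_unit Ux))); apply/funext => z.
  rewrite metric_christoffel // (sb0l (metric_sb Ux)).
  have [_ <-] := F1_derive 0 w Ux.
  by rewrite derive0 (sb0l edot_sb).
by rewrite subr0.
Qed.

(** Differentiating the tangential part of [F2] twice produces third derivatives of the immersion;
    these cancel by [F3C], and products with [normal_hess] remain. *)
Lemma gauss_equation x u v w z : U x -> riemann g x u v w z =
  edot (normal_hess x v w) (normal_hess x u z)
  - edot (normal_hess x u w) (normal_hess x v z).
Proof.
move=> Ux.
(* The tangential part of [F2 c z x] is orthogonal to the normal vector in the other factor. *)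
have nE a b c : edot (normal_hess x a b) (normal_hess x c z) =
    edot (normal_hess x a b) (F2 c z x).
  rewrite [normal_hess x c z]/normal_hess (sbDr edot_sb) (sbNr edot_sb).
  by rewrite (normal_hess_orth _ _ _ Ux) oppr0 addr0.
apply: etrans _ (esym (f_equal2 (fun a b => a - b) (nE v w u) (nE u w v))).
rewrite /riemann (curv_opE _ _ _ Ux).
rewrite (sbDl (metric_sb Ux)) (sbNl (metric_sb Ux)).
transitivity (
  (edot ('D_u (F2 v w) x) (F1 z x) + edot (normal_hess x v w) (F2 u z x))
  - (edot ('D_u (F2 v w) x) (F1 z x) + edot (normal_hess x u w) (F2 v z x))).
  congr (_ - _); first exact: metric_nabla_nabla.
  by rewrite (F3C u v w Ux); exact: metric_nabla_nabla.
by move: (normal_hess x) ('D_u (F2 v w) x) => h d; ring.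
Qed.

(** The Gauss equation reduces this to bilinearity of the second fundamental form and of the inner
    product. *)
Lemma riemann_multilinear x : U x -> multilinear4 (riemann g x).
Proof.
move=> Ux; have hC u v := @normal_hessC x u v Ux.
have hP a u v w := @normal_hessP x a u v w Ux.
have RE u v w z := @gauss_equation x u v w z Ux.
move: (riemann g x) (normal_hess x) RE hC hP => Rm h RE hC hP.
have hPr a u v w : h w (a *: u + v) = a *: h w u + h w v.
  by rewrite hC hP !(hC w).
split=> a u v X Y Z; rewrite !RE ?hP ?hPr.
all: by rewrite !(sbE edot_sb); ring.
Qed.

(** Rewriting the trace through the (0,4)-tensor gives the Gauss equation access to Ricci. *)
Lemma ricciE x X Y : U x -> ricci g x X Y =
  \sum_i \sum_j riemann g x (e_ i) X Y (e_ j) * invmx (gram (g x)) j i.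
Proof.
move=> Ux; rewrite /ricci /trace_op /mxtrace; apply: eq_bigr => i _.
rewrite mxE -(sharpK (metric_sb Ux) (metric_unit Ux) (curv_op _ _ _ _ _)).
by rewrite /sharp mxE; apply: eq_bigr => j _; rewrite mxE.
Qed.

Lemma ricci_sb x : U x -> symmetric_bilinear (ricci g x).
Proof.
move=> Ux; have [_ RP _ _] := riemann_multilinear Ux.
have hC u v := @normal_hessC x u v Ux.
have RE u v w z := @gauss_equation x u v w z Ux.
have ricE X Y := @ricciE x X Y Ux.
have invC i j : invmx (gram (g x)) i j = invmx (gram (g x)) j i.
  have gT : (gram (g x))^T = gram (g x).
    by apply/matrixP => a b; rewrite !mxE; exact: (metric_sb Ux).2.
  by rewrite -[in LHS]gT -trmx_inv mxE.
move: (riemann g x) (ricci g x) (normal_hess x) (invmx _) RE hC RP ricE invC.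
move=> Rm S h I RE hC RP SE IC.
split=> [a u v w|u v].
  rewrite !SE mulr_sumr -big_split; apply: eq_bigr => i _.
  rewrite mulr_sumr -big_split; apply: eq_bigr => j _.
  by rewrite RP /=; ring.
(* Symmetry of Ricci comes from the pair symmetry of the Gauss expression, after the summation
   indices are exchanged. *)
rewrite !SE exchange_big; apply: eq_bigr => i _; apply: eq_bigr => j _.
rewrite (IC i j) !RE (hC v u) (hC (e_ j) (e_ i)) (hC u (e_ i)) (hC (e_ j) v).
by rewrite (edotC (h v (e_ j))).
Qed.

End GaussEquation.

(** * The geometry induced by a smooth immersion *)

Section SmoothMaps.
Context {R : realType} {n N : nat}.
Local Notation V := 'rV[R]_n.
Local Notation E := 'rV[R]_N.
Variables (U : set V).
Hypothesis U_open : open U.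
Implicit Types (F G : V -> E) (x y u v w z : V).

Lemma derive_commute_rV G x u v : U x ->
  (forall y, U y -> differentiable G y) ->
  (forall w y, U y -> differentiable (fun z => 'D_w G z) y) ->
  'D_u (fun y => 'D_v G y) x = 'D_v (fun y => 'D_u G y) x.
Proof.
move=> Ux dG ddG.
have derG w k : \forall y \near x,
    is_derive y w (fun z => G z 0 k) (('D_w G y) 0 k).
  apply: filterS (open_nbhs_nbhs (conj U_open Ux)) => y Uy.
  have dGy : derivable G y w by apply: diff_derivable; exact: dG.
  by apply: DeriveDef; [exact: derivable_entry|exact: derive_entry].
have difG w k : differentiable (fun y => ('D_w G y) 0 k) x.
  apply: (@differentiable_comp _ _ _ _ (fun y => 'D_w G y)
    (fun A : E => A 0 k)); first exact: ddG.
  exact: differentiable_coord.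
have ddG' w z : derivable (fun y => 'D_w G y) x z.
  by apply: diff_derivable; exact: ddG.
apply/rowP => k.
apply: etrans (esym (derive_entry 0 k (ddG' v u))) _.
apply: etrans _ (derive_entry 0 k (ddG' u v)).
exact: derive_commute (derG v k) (derG u k) (difG v k) (difG u k).
Qed.

Lemma derive_lincomb G y a u v : differentiable G y ->
  'D_(a *: u + v) G y = a *: 'D_u G y + 'D_v G y.
Proof.
move=> dG; apply: etrans (deriveEjacobian _ dG) _; rewrite mulmxDl -scalemxAl.
by congr (_ *: _ + _); apply: esym; exact: deriveEjacobian.
Qed.

Lemma smooth_diff F y : smooth_on U F -> U y -> differentiable F y.
Proof. by move=> /(_ 1)[+ _] Uy; exact. Qed.

Lemma smooth_derive F v : smooth_on U F -> smooth_on U (fun y => 'D_v F y).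
Proof. by move=> F_smooth k; have [_] := F_smooth k.+1; exact. Qed.

(** This collects all that the tensor algebra needs at a point, by checking that the actual
    derivatives of [F] satisfy the hypotheses on [F1] and [F2]. *)
Lemma induced_geometry F x : smooth_on U F ->
  (forall y, U y -> row_free ('J F y)) -> U x ->
  let g := induced_metric F in
  [/\ symmetric_bilinear (g x), gram (g x) \in unitmx,
      symmetric_bilinear (ricci g x) & multilinear4 (riemann g x)].
Proof.
move=> F_smooth F_immersive Ux g.
pose F1 v y := 'D_v F y; pose F2 u v y := 'D_u (F1 v) y.
have F1_smooth v : smooth_on U (F1 v) by exact: smooth_derive.
have F2_smooth u v : smooth_on U (F2 u v) by exact: smooth_derive.
have gE y u v : g y u v = edot (F1 u y) (F1 v y) by [].
have F1P a u v y : U y -> F1 (a *: u + v) y = a *: F1 u y + F1 v y.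
  by move=> Uy; apply: derive_lincomb; exact: smooth_diff.
have F1_inj u y : U y -> F1 u y = 0 -> u = 0.
  move=> Uy Fu0; apply: (row_free_inj (F_immersive y Uy)).
  rewrite mul0mx -[RHS]Fu0; apply: esym; apply: deriveEjacobian.
  exact: smooth_diff.
have F1_derive u v y : U y -> is_derive y u (F1 v) (F2 u v y).
  move=> Uy; apply: DeriveDef => //; apply: diff_derivable.
  exact: smooth_diff.
have F2P a u v w y : U y -> F2 (a *: u + v) w y = a *: F2 u w y + F2 v w y.
  by move=> Uy; apply: derive_lincomb; exact: smooth_diff.
have F2C u v y : U y -> F2 u v y = F2 v u y.
  move=> Uy; apply: (@derive_commute_rV F y u v Uy) => [z|w z].
    exact: smooth_diff.
  exact: (smooth_diff (F1_smooth w)).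
have F2_derivable u v w y : U y -> derivable (F2 v w) y u.
  by move=> Uy; apply: diff_derivable; exact: smooth_diff.
(* Schwarz' theorem again, now for [F1 w] in place of [F]. *)
have F3C u v w y : U y -> 'D_u (F2 v w) y = 'D_v (F2 u w) y.
  move=> Uy; apply: (@derive_commute_rV (F1 w) y u v Uy) => [z|w' z].
    exact: (smooth_diff (F1_smooth w)).
  exact: (smooth_diff (F2_smooth w' w)).
clearbody F1 F2 g; split.
- exact: metric_sb gE F1P x Ux.
- exact: metric_unit gE F1P F1_inj x Ux.
- by apply: (@ricci_sb _ _ _ U F1 F2).
- by apply: (@riemann_multilinear _ _ _ U F1 F2).
Qed.

End SmoothMaps.

(** * The identity at a point, read in a chart *)

Theorem theorem3p9 (R : realType) (n m : nat) (M : topologicalType)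
    (A : set (chart R M n)) (f : M -> 'rV[R]_(n + m)) (L LC : M -> R)
    (n_ge4 : (4 <= n)%N) (m_ge1 : (1 <= m)%N)
    (M_manifold : smooth_manifold A) (f_immersion : immersion A f)
    (f_ideal : chen_ideal A f)
    (L_def : forall c p, A c -> dom c p -> weyl_locus A f p ->
       let g := metric_in f c in let x := c p in
       dot4 (g x) (riemann g x) (riemann g x)
         - tachibana (ricci g x) (riemann g x)
       = L p *: tachibana (g x) (weyl g x))
    (LC_def : forall c p, A c -> dom c p -> weyl_locus A f p ->
       let g := metric_in f c in let x := c p in
       dot4 (g x) (weyl g x) (weyl g x) = LC p *: tachibana (g x) (weyl g x)) :
  forall c p, A c -> dom c p -> weyl_locus A f p ->
    let g := metric_in f c in let x := c p in
    let S := ricci g x in let kappa := scalar_curv g x in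
    dot4 (g x) (weyl g x) (riemann g x) + dot4 (g x) (riemann g x) (weyl g x)
    = tachibana S (weyl g x) + (L p + LC p) *: tachibana (g x) (weyl g x)
      - ((n%:R - 2) ^+ 2)^-1 *:
          tachibana (g x)
            (((n%:R - 2) / 2) *: kulkarni_nomizu S S - kappa *: kulkarni_nomizu (g x) S
             + kulkarni_nomizu (g x) (square2 (g x) S)).
Proof.
move=> c p Ac dp wp g x S kappa.
have [_ _ _ [A_chart _ _]] := M_manifold.
have [_ cod_open _ _ _] := A_chart c Ac.
have [F_smooth F_immersive] := f_immersion c Ac.
have Ux : codom_chart c x by exists p.
have [g_sb g_unit S_sb R_ml] :=
  induced_geometry cod_open F_smooth F_immersive Ux.
have n_gt2 : (2 < n)%N by exact: leq_trans n_ge4.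
have hL := L_def c p Ac dp wp; have hLC := LC_def c p Ac dp wp.
tensor6_ext X1 X2 X3 X4 X Y.
(* The pointwise equations for the Weyl tensor and for the last tensor hold by unfolding; the two
   curvature conditions are evaluated at vectors. *)
apply: (weyl_curvature_identity (kappa := kappa) g_sb g_unit S_sb R_ml n_gt2).
- by [].
- by [].
- move=> Y1 Y2 Y3 Y4 Y5 Y6.
  exact: (congr1 (fun T => T Y1 Y2 Y3 Y4 Y5 Y6) hL).
- move=> Y1 Y2 Y3 Y4 Y5 Y6.
  exact: (congr1 (fun T => T Y1 Y2 Y3 Y4 Y5 Y6) hLC).
Qed.
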